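(* Let $\hat A=\Sigma\hat A_N\Sigma^{-1}$, where $\hat A_N\in\mathbb{R}^{n\times n}$ is normal and $\Sigma\in\mathbb{R}^{n\times n}$ is diagonal with positive diagonal entries. Apply the block Lanczos algorithm (described in the context) to $\hat A$ with starting blocks $(V_1,W_1)$, where $V_1,W_1\in\mathbb{R}^{n\times s}$ and $W_1^TV_1=I_s$, and to $\hat A_N$ with scaled starting blocks $(\Sigma^{-1}V_1,\Sigma W_1)$. Then, for all $j$ reached without breakdown, the resulting projected matrices and bases satisfy $$\tilde T_{j,\hat A}=\tilde T_{j,\hat A_N},\qquad \mathcal V_{j,\hat A}=\Sigma\,\mathcal V_{j,\hat A_N},\qquad \mathcal W_{j,\hat A}=\Sigma^{-1}\mathcal W_{j,\hat A_N}.$$ Moreover, let $\tilde T_{j,\hat A}Y_j=Y_j\Lambda$, where $\Lambda$ is the diagonal matrix of the $s$ eigenvalues of $\tilde T_{j,\hat A}=\tilde T_{j,\hat A_N}$ of largest real part and the columns of $Y_j$ are associated eigenvectors, and set $Z_{\hat A}=\mathcal V_{j,\hat A}Y_j$, $Z_{\hat A_N}=\mathcal V_{j,\hat A_N}Y_j$, $R_{\hat A}=\hat AZ_{\hat A}-Z_{\hat A}\Lambda$, $R_{\hat A_N}=\hat A_NZ_{\hat A_N}-Z_{\hat A_N}\Lambda$. Then $$Z_{\hat A_N}=\Sigma^{-1}Z_{\hat A}\qquad\text{and}\qquad \|R_{\hat A}\|_F=\|\hat AZ_{\hat A}-Z_{\hat A}\Lambda\|_F=\|\Sigma R_{\hat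 A_N}\|_F.$$
   Context: Block Lanczos algorithm for a matrix $M\in\mathbb{R}^{n\times n}$ with starting blocks $V_1,W_1\in\mathbb{R}^{n\times s}$, $W_1^TV_1=I_s$. Set $B_1=C_1=0_{s\times s}$ and $V_0=W_0=0_{n\times s}$. For $j=1,2,\dots$: (a) $A_j=W_j^TMV_j$; (b) $\widehat V_{j+1}=MV_j-V_jA_j-V_{j-1}B_j$; (c) $\widehat W_{j+1}=M^TW_j-W_jA_j^T-W_{j-1}C_j^T$; (d) compute the QR decomposition $\widehat W_{j+1}^T\widehat V_{j+1}=B_{j+1}C_{j+1}$, with $B_{j+1}\in\mathbb{R}^{s\times s}$ orthogonal and $C_{j+1}\in\mathbb{R}^{s\times s}$ upper triangular, normalized to have positive diagonal so that it is unique when the matrix is nonsingular; (e) $W_{j+1}=\widehat W_{j+1}B_{j+1}$ and $V_{j+1}=\widehat V_{j+1}C_{j+1}^{-1}$. A breakdown occurs if some $C_{j+1}$ is singular; step $j$ is reached without breakdown if $C_2,\dots,C_j$ are nonsingular. Write $\mathcal V_{j,M}=[V_1,\dots,V_j]$ and $\mathcal W_{j,M}=[W_1,\dots,W_j]$ in $\mathbb{R}^{n\times js}$. The projected matrix $\tilde T_{j,M}\in\mathbb{R}^{js\times js}$ is the block tridiagonal matrix with diagonal blocks $A_1,\dots,A_j$, superdiagonal blocks $B_2,\dots,B_j$ (block $B_i$ in block position $(i-1,i)$) and subdiagonal blocks $C_2,\dots,C_j$ (block $C_i$ in block position $(i,i-1)$). $\|\cdot\|_F$ denotes the Frobenius norm.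 *)

(* Defs.v *)
From HB Require Import structures.
From mathcomp Require Import all_boot all_order all_algebra.
From mathcomp Require Export complex.

Set Implicit Arguments.
Unset Strict Implicit.
Unset Printing Implicit Defensive.

Import Order.TTheory GRing.Theory Num.Theory.
Local Open Scope ring_scope.

(* Blocks are indexed from 1 as in the recurrence; only index 0 of lanV and
   lanW is used (as V_0 = W_0 = 0), not that of lanA, lanB, lanC. *)
Record lanczos_data (R : Type) (n s : nat) := LanczosData {
  lanV : nat -> 'M[R]_(n, s);
  lanW : nat -> 'M[R]_(n, s);
  lanA : nat -> 'M[R]_s;
  lanB : nat -> 'M[R]_s;
  lanC : nat -> 'M[R]_s
}.

(* S = Q *m U with Q orthogonal and U upper triangular ([is_trig_mx] means
   lower triangular); the positivity constraint makes (Q, U) unique when S is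
   nonsingular. A singular S admits no U with a positive diagonal. *)
Definition is_qr (R : realFieldType) (s : nat) (S Q U : 'M[R]_s) : Prop :=
  [/\ S = Q *m U, Q^T *m Q = 1%:M, is_trig_mx U^T
    & S \in unitmx -> forall i, 0 < U i i].

Section BlockLanczos.
Variables (R : realFieldType) (n s : nat).
Implicit Types (M : 'M[R]_n) (L : lanczos_data R n s).

Definition no_breakdown L (j : nat) : Prop :=
  forall i, (2 <= i <= j)%N -> lanC L i \in unitmx.

Definition hatV M L (j : nat) : 'M[R]_(n, s) :=
  M *m lanV L j - lanV L j *m lanA L j - lanV L j.-1 *m lanB L j.

Definition hatW M L (j : nat) : 'M[R]_(n, s) :=
  M^T *m lanW L j - lanW L j *m (lanA L j)^T - lanW L j.-1 *m (lanC L j)^T.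

Definition lanczos_init (V1 W1 : 'M[R]_(n, s)) L : Prop :=
  [/\ lanV L 0 = 0 /\ lanW L 0 = 0, lanV L 1 = V1 /\ lanW L 1 = W1
    & lanB L 1 = 0 /\ lanC L 1 = 0].

Definition lanczos_step M L (j : nat) : Prop :=
  [/\ lanA L j = (lanW L j)^T *m M *m lanV L j,
      is_qr ((hatW M L j)^T *m hatV M L j) (lanB L j.+1) (lanC L j.+1)
    & lanC L j.+1 \in unitmx ->
        lanW L j.+1 = hatW M L j *m lanB L j.+1 /\
        lanV L j.+1 = hatV M L j *m invmx (lanC L j.+1)].

(* L records a run of the algorithm, which stops at the first breakdown; the
   entries of L beyond that point are unconstrained. *)
Definition block_lanczos M (V1 W1 : 'M[R]_(n, s)) L : Prop :=
  lanczos_init V1 W1 L /\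
  forall j, (1 <= j)%N -> no_breakdown L j -> lanczos_step M L j.

(* The index type of the j blocks of size s is \sum_(i < j) s, that is, j * s.
   Block position (i, k) below is (i + 1, k + 1) when counting from 1. *)
Definition basisV L (j : nat) : 'M[R]_(n, \sum_(i < j) s) :=
  \mxrow_(i < j) lanV L i.+1.

Definition basisW L (j : nat) : 'M[R]_(n, \sum_(i < j) s) :=
  \mxrow_(i < j) lanW L i.+1.

Definition projT L (j : nat) : 'M[R]_(\sum_(i < j) s) :=
  \mxblock_(i < j, k < j)
    (if k == i :> nat then lanA L i.+1
     else if k == i.+1 :> nat then lanB L k.+1
     else if i == k.+1 :> nat then lanC L i.+1
     else 0).

End BlockLanczos.

Section Ritz.
Variable R : rcfType.

Definition toC (m p : nat) (A : 'M[R]_(m, p)) : 'M[R[i]]_(m, p) :=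
  map_mx (real_complex R) A.

(* The entries of lam are s of the eigenvalues of T, counted with algebraic
   multiplicity; r lists the remaining ones. Ties are broken arbitrarily. *)
Definition largest_Re_eigenvalues (m s : nat) (T : 'M[R]_m)
    (lam : 'rV[R[i]]_s) : Prop :=
  exists r : seq R[i],
    char_poly (toC T) =
      \prod_(i < s) ('X - (lam 0 i)%:P) * \prod_(z <- r) ('X - z%:P) /\
    forall (i : 'I_s) (z : R[i]), z \in r ->
      complex.Re z <= complex.Re (lam 0 i).

Definition frobenius (m p : nat) (A : 'M[R[i]]_(m, p)) : R :=
  Num.sqrt (\sum_i \sum_j ComplexField.Normc.normc (A i j) ^+ 2).

End Ritz.

(* Main.v *)
(* If V = P V' and W = P^-T W' hold for the current blocks, with M = P M' P^-1,
   then the recurrences give the same relations for the residual blocks, and P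
   cancels in A_j = W_j^T M V_j and in the matrix that is QR-factored. Both runs
   thus factor the same matrix; when it is nonsingular the factorization is
   unique, so that the relations pass to step j + 1. A diagonal Sigma is the
   case P = P^T. *)
Require Import Defs.
From mathcomp Require Import all_boot all_order all_algebra.
From mathcomp Require Import reals.
Import Order.TTheory GRing.Theory Num.Theory.
Local Open Scope ring_scope.

Set Implicit Arguments.
Unset Strict Implicit.
Unset Printing Implicit Defensive.

(* Row k of the product U^T *m U determines row k of U from the rows above it,
   the positive diagonal entry being a square root. *)
Lemma cholesky_unique (R : realFieldType) (s : nat) (U U' : 'M[R]_s) :
  is_trig_mx U^T -> is_trig_mx U'^T ->
  (forall i, 0 < U i i) -> (forall i, 0 < U' i i) ->
  U^T *m U = U'^T *m U' -> U = U'.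
Proof.
move=> /is_trig_mxP trU /is_trig_mxP trU' U_gt0 U'_gt0 eqUU.
suff rowE m (k : 'I_s) : (k < m)%N -> forall l, U k l = U' k l.
  by apply/matrixP => k l; apply: (rowE k.+1).
elim: m k => [//|m IHm] k; rewrite ltnS => le_km.
(* Upper triangularity kills the terms with [i > k], so row [k] of the Gram matrix sees only row [k]
   of [T] and the rows above it. *)
have gramE (T : 'M[R]_s) (trT : forall i j : 'I_s, (i < j)%N -> T^T i j = 0) l :
    (T^T *m T) k l
      = \sum_(i < s | (i < k)%N) T i k * T i l + T k k * T k l.
  rewrite !mxE (bigID (fun i : 'I_s => (i < k)%N)) /=; congr (_ + _).
    by apply: eq_bigr => i _; rewrite mxE.
  rewrite (bigD1 k) ?ltnn //= big1 ?addr0 ?mxE // => i /andP[Nlt_ik ne_ik].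
  by rewrite trT ?mul0r // ltn_neqAle leqNgt Nlt_ik eq_sym ne_ik.
have {gramE} prodE l : U k k * U k l = U' k k * U' k l.
  have := congr1 (fun T : 'M[R]_s => T k l) eqUU.
  rewrite !gramE // (eq_bigr (fun i => U' i k * U' i l)); first exact: addrI.
  by move=> i lt_ik; rewrite !IHm // (leq_trans lt_ik).
have diagE : U k k = U' k k.
  by apply/eqP; rewrite -(@eqrXn2 _ 2) ?ltW // !expr2 prodE.
by move=> l; apply: (mulfI (lt0r_neq0 (U_gt0 k))); rewrite prodE diagE.
Qed.

(** An orthogonal factor is invertible. Breakdown, a condition on the triangular factor, can thus be
    read off the matrix being factored. *)
Lemma qr_unit (R : realFieldType) (s : nat) (S Q U : 'M[R]_s) :
  is_qr S Q U -> (S \in unitmx) = (U \in unitmx).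
Proof.
by case=> -> /mulmx1_unit[_ unitQ] _ _; rewrite unitmx_mul unitQ.
Qed.

(** Passing to [S^T *m S] eliminates the orthogonal factor and leaves two Cholesky factorizations of
    one matrix; then [Q] is recovered as [S] times the inverse of [U]. *)
Lemma qr_unique (R : realFieldType) (s : nat) (S Q U Q' U' : 'M[R]_s) :
  S \in unitmx -> is_qr S Q U -> is_qr S Q' U' -> Q = Q' /\ U = U'.
Proof.
move=> unitS qrS qrS'; have unitU : U \in unitmx by rewrite -(qr_unit qrS).
case: qrS qrS' => SE orthQ trU /(_ unitS) U_gt0 [SE' orthQ' trU' /(_ unitS) U'_gt0].
have gram : S^T *m S = U^T *m U.
  by rewrite SE trmx_mul mulmxA -(mulmxA U^T) orthQ mulmx1.
have gram' : S^T *m S = U'^T *m U'.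
  by rewrite SE' trmx_mul mulmxA -(mulmxA U'^T) orthQ' mulmx1.
have eqU : U = U' by apply: cholesky_unique => //; rewrite -gram.
by split=> //; rewrite -(mulmxK unitU Q) -SE SE' eqU mulmxK // -eqU.
Qed.

(** The induction invariant, with [Q] standing for the inverse of [P]. The bases start at index 0
    because a step also reads the preceding blocks. [lanA] is left out, being determined by the
    bases at the same index. *)
Definition lanczos_similar (R : realFieldType) (n s : nat) (P Q : 'M[R]_n)
    (L L' : lanczos_data R n s) (j : nat) : Prop :=
  (forall i, (i <= j)%N ->
     lanV L i = P *m lanV L' i /\ lanW L i = Q^T *m lanW L' i) /\
  (forall i, (1 <= i <= j)%N -> lanB L i = lanB L' i /\ lanC L i = lanC L' i).

Section Similarity.
Variables (R : realFieldType) (n s : nat) (P Q M M' : 'M[R]_n).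
Variables (L L' : lanczos_data R n s).
Hypotheses (PQ : P *m Q = 1%:M) (ME : M = P *m M' *m Q).

Let QP : Q *m P = 1%:M. Proof. exact: mulmx1C. Qed.

Lemma lanczos_similarA j :
  lanV L j = P *m lanV L' j -> lanW L j = Q^T *m lanW L' j ->
  lanczos_step M L j -> lanczos_step M' L' j -> lanA L j = lanA L' j.
Proof.
move=> VE WE [-> _ _] [-> _ _].
rewrite VE WE ME trmx_mul trmxK !mulmxA -(mulmxA _ Q P) QP mulmx1.
by rewrite -(mulmxA _ Q P) QP mulmx1.
Qed.

Lemma lanczos_similar_hat j : (1 <= j)%N -> lanczos_similar P Q L L' j ->
  lanczos_step M L j -> lanczos_step M' L' j ->
  hatV M L j = P *m hatV M' L' j /\ hatW M L j = Q^T *m hatW M' L' j.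
Proof.
move=> j_gt0 [VWE BCE] stepL stepL'.
have [VE WE] := VWE j (leqnn j); have [V'E W'E] := VWE j.-1 (leq_pred j).
have /BCE[BE CE] : (1 <= j <= j)%N by rewrite j_gt0 leqnn.
rewrite /hatV /hatW (lanczos_similarA VE WE stepL stepL') VE WE V'E W'E BE CE ME.
rewrite !trmx_mul !mulmxBr !mulmxA; split; congr (_ - _ - _).
  by rewrite -(mulmxA _ Q P) QP mulmx1.
(* For the transposed recurrence the cancelling factor is [P^T *m Q^T], the transpose of
   [Q *m P]. *)
by rewrite -(mulmxA _ P^T) -(trmx_mul Q P) QP trmx1 mulmx1.
Qed.

(** Absence of breakdown is assumed for [L] alone and derived for [L'], so exchanging the two runs
    yields the converse. *)
Lemma lanczos_similarP (V1 W1 V1' W1' : 'M[R]_(n, s)) j :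
  V1 = P *m V1' -> W1 = Q^T *m W1' ->
  block_lanczos M V1 W1 L -> block_lanczos M' V1' W1' L' ->
  (1 <= j)%N -> no_breakdown L j ->
  no_breakdown L' j /\ lanczos_similar P Q L L' j.
Proof.
move=> V1E W1E [initL runL] [initL' runL'].
elim: j => [//|[_ _ _|j IHj _ nbS]].
  split; first by case=> [|[]].
  case: initL initL' => [[V0 W0] [VE WE] [BE CE]] [[V0' W0'] [VE' WE'] [BE' CE']].
  split=> [[|[|//]] _|[|[|//]] // _].
  - by rewrite V0 W0 V0' W0' !mulmx0.
  - by rewrite VE WE VE' WE'.
  - by rewrite BE CE BE' CE'.
have nb : no_breakdown L j.+1.
  by move=> i /andP[? le_ij]; apply: nbS; rewrite (leqW le_ij) andbT.
have [nb' simj] := IHj isT nb.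
have stepL := runL j.+1 isT nb; have stepL' := runL' j.+1 isT nb'.
have [VE WE] := lanczos_similar_hat (ltn0Sn j) simj stepL stepL'.
have unitC : lanC L j.+2 \in unitmx by apply: nbS; rewrite /= leqnn.
case: stepL stepL' => _ qrL /(_ unitC)[WL VL] [_ qrL' runL'1].
have SE : (hatW M L j.+1)^T *m hatV M L j.+1
        = (hatW M' L' j.+1)^T *m hatV M' L' j.+1.
  by rewrite VE WE trmx_mul trmxK mulmxA -(mulmxA _ Q P) QP mulmx1.
(* Nonsingularity travels from [lanC L j.+2] to the common matrix, and by uniqueness of its factors
   to [lanC L' j.+2], which lets the second run continue. *)
have unitS : (hatW M L j.+1)^T *m hatV M L j.+1 \in unitmx.
  by rewrite (qr_unit qrL).
rewrite -SE in qrL'; have [BE CE] := qr_unique unitS qrL qrL'.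
have unitC' : lanC L' j.+2 \in unitmx by rewrite -CE.
have [WL' VL'] := runL'1 unitC'; case: simj => VWE BCE.
split; last split.
- move=> i /andP[i_gt1]; rewrite leq_eqVlt => /predU1P[-> //|le_ij].
  by apply: nb'; rewrite i_gt1.
- move=> i; rewrite leq_eqVlt => /predU1P[->|]; last exact: VWE.
  by rewrite WL VL WL' VL' VE WE -BE -CE !mulmxA.
- move=> i /andP[i_gt0]; rewrite leq_eqVlt => /predU1P[-> //|le_ij].
  by apply: BCE; rewrite i_gt0.
Qed.

Lemma lanczos_similar_projT (V1 W1 V1' W1' : 'M[R]_(n, s)) j :
  block_lanczos M V1 W1 L -> block_lanczos M' V1' W1' L' ->
  no_breakdown L j -> no_breakdown L' j -> lanczos_similar P Q L L' j ->
  projT L j = projT L' j.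
Proof.
move=> [_ runL] [_ runL'] nb nb' [VWE BCE].
apply/eq_mxblockP => i k; case: eqP => [_|_].
  have [VE WE] := VWE i.+1 (ltn_ord i).
  by apply: lanczos_similarA => //; [apply: runL|apply: runL'] => // m /andP[? le_mi];
    [apply: nb|apply: nb']; rewrite (leq_trans le_mi (ltn_ord i)) andbT.
case: eqP => [_|_]; first by have [] := BCE k.+1 (ltn_ord k).
by case: eqP => [_|//]; have [] := BCE i.+1 (ltn_ord i).
Qed.

End Similarity.

Theorem theorem4p3 (R : realType) (n s : nat) (Ahat AN Sig : 'M[R]_n)
    (V1 W1 : 'M[R]_(n, s)) (L LN : lanczos_data R n s) :
  comm_mx AN AN^T ->
  is_diag_mx Sig ->
  (forall i, 0 < Sig i i) ->
  Ahat = Sig *m AN *m invmx Sig ->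
  W1^T *m V1 = 1%:M ->
  block_lanczos Ahat V1 W1 L ->
  block_lanczos AN (invmx Sig *m V1) (Sig *m W1) LN ->
  forall j : nat, (1 <= j)%N ->
  (no_breakdown L j <-> no_breakdown LN j) /\
  (no_breakdown L j ->
   [/\ projT L j = projT LN j,
       basisV L j = Sig *m basisV LN j,
       basisW L j = invmx Sig *m basisW LN j
     & forall (lam : 'rV[R[i]]_s) (Y : 'M[R[i]]_(\sum_(i < j) s, s)),
       largest_Re_eigenvalues (projT L j) lam ->
       (forall i : 'I_s, col i Y != 0) ->
       toC (projT L j) *m Y = Y *m diag_mx lam ->
       let Lam := diag_mx lam in
       let Z := toC (basisV L j) *m Y in
       let ZN := toC (basisV LN j) *m Y in
       let RA := toC Ahat *m Z - Z *m Lam in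
       let RN := toC AN *m ZN - ZN *m Lam in
       [/\ ZN = toC (invmx Sig) *m Z,
           frobenius RA = frobenius (toC Ahat *m Z - Z *m Lam)
         & frobenius RA = frobenius (toC Sig *m RN)]]).
Proof.
move=> _ diagSig Sig_gt0 AE _ runL runLN j j_gt0.
have trSig : Sig^T = Sig.
  have /is_diag_mxP dS := diagSig; apply/matrixP => i k; rewrite mxE.
  by have [->//|ne_ik] := eqVneq i k; rewrite !dS // eq_sym.
have unitSig : Sig \in unitmx.
  rewrite unitmxE det_trig ?is_diag_mx_is_trig // unitfE prodf_seq_neq0.
  by apply/allP => i _; rewrite implyTb lt0r_neq0.
have SV : Sig *m invmx Sig = 1%:M by exact: mulmxV.
have VS : invmx Sig *m Sig = 1%:M by exact: mulVmx.
have trV : (invmx Sig)^T = invmx Sig by rewrite trmx_inv trSig.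
have nbN_sim : no_breakdown L j ->
    no_breakdown LN j /\ lanczos_similar Sig (invmx Sig) L LN j.
  apply: (lanczos_similarP SV AE _ _ runL runLN j_gt0); first by rewrite mulKVmx.
  by rewrite trV mulKmx.
(* The inverse similarity, with [invmx Sig] as [P] and [Sig] as [Q], gives the converse on
   breakdowns. *)
have ANE : AN = invmx Sig *m Ahat *m Sig by rewrite AE !mulmxA VS mul1mx mulmxKV.
have nbE : no_breakdown L j <-> no_breakdown LN j.
  split=> [/nbN_sim[] // | nbN].
  apply: (proj1 (lanczos_similarP VS ANE erefl _ runLN runL j_gt0 nbN)).
  by rewrite trSig.
split=> // nb; have [nbN simj] := nbN_sim nb.
have basisVE : basisV L j = Sig *m basisV LN j.
  by rewrite mul_mxrow; apply/eq_mxrowP => i; case: (simj.1 i.+1 (ltn_ord i)).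
have basisWE : basisW L j = invmx Sig *m basisW LN j.
  rewrite mul_mxrow; apply/eq_mxrowP => i.
  by case: (simj.1 i.+1 (ltn_ord i)) => _; rewrite trV.
split=> //.
  exact: (lanczos_similar_projT SV AE runL runLN).
move=> lam Y _ _ _ Lam Z ZN RA RN.
have ZE : Z = toC Sig *m ZN by rewrite /Z basisVE [toC _]map_mxM mulmxA.
split=> //; first by rewrite ZE mulmxA -[_ *m toC Sig]map_mxM VS map_mx1 mul1mx.
(* The residuals satisfy [RA = toC Sig *m RN] already as matrices, since [Ahat] times [Sig] is [Sig]
   times [AN]. *)
congr frobenius; rewrite /RA /RN mulmxBr ZE !mulmxA -!map_mxM AE.
by rewrite mulmxKV.
Qed.
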